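(* Let $F(n,i,j)$ be a hypergeometric term in $n,i,j$ (all three shift quotients $F(n+1,i,j)/F$, $F(n,i+1,j)/F$, $F(n,i,j+1)/F$ are rational functions of $n,i,j$). Treat $n$ as a parameter, so that all polynomials below are polynomials in $i,j$ with coefficients in a field $K$ of characteristic zero containing the rational functions of $n$ (e.g. $K=\mathbb{Q}(n)$). Write $$\frac{F(n,i+1,j)}{F(n,i,j)}=\frac{r_1(i,j)}{s_1(i,j)},\qquad \frac{F(n,i,j+1)}{F(n,i,j)}=\frac{r_2(i,j)}{s_2(i,j)}$$ with $r_1,s_1$ relatively prime and $r_2,s_2$ relatively prime, and set $s_1'=s_1/\gcd(s_1,s_2)$, $s_2'=s_2/\gcd(s_1,s_2)$. Let $r\ge 0$ and let $d(i,j)$ be the common denominator of $F(n+l,i,j)/F(n,i,j)$ for $l=1,\dots,r$ (with $d=1$ if $r=0$). Suppose $L=a_0(n)+a_1(n)N+\cdots+a_r(n)N^r$ and rational functions $$R_1=\frac{1}{d(i,j)}\cdot\frac{f_1(i,j)}{g_1(i,j)},\qquad R_2=\frac{1}{d(i,j)}\cdot\frac{f_2(i,j)}{g_2(i,j)},$$ with $f_1,g_1$ relatively prime and $f_2,g_2$ relatively prime, satisfy $$LF(n,i,j)=\Delta_i\big(R_1F(n,i,j)\big)+\Delta_j\big(R_2F(n,i,j)\big).$$ Let $v=\gcd(g_1,g_2)$, $g_1'=g_1/v$, $g_2'=g_2/v$, and assume: (H1) for each $k\in\{1,2\}$: if $p(i,j)$ and $p(i+h_1,j+h_2)$ are both irreducible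 factors of $g_k(i,j)$ for some $h_1,h_2\in\{-1,0,1\}$, then $p(i+h_1,j+h_2)=p(i,j)$ (up to a nonzero constant factor); (H2) $\gcd(g_1',v)=\gcd(g_2',v)=1$; (H3) for all $h_1,h_2\in\{-1,0,1\}$, $\gcd\big(g_1'(i+h_1,j+h_2),g_2'(i,j)\big)=1$; and moreover for all $h_1,h_2\in\{-1,0,1\}$, $$\gcd\big(g_1(i,j),d(i+h_1,j+h_2)\big)=\gcd\big(g_2(i,j),d(i+h_1,j+h_2)\big)=1.$$ Then there exist polynomials $v_1(i)$, $w_1(i)$ in $i$ alone, $v_2(j)$, $u_1(j)$ in $j$ alone, $v_3(t)$ in one variable, and $v_4(i,j),u_2(i,j),w_2(i,j)$ such that $$g_1(i,j)=v_1(i)\,v_2(j)\,v_3(i+j)\,v_4(i,j)\,u_1(j)\,u_2(i,j),\qquad g_2(i,j)=v_1(i)\,v_2(j)\,v_3(i+j)\,v_4(i,j)\,w_1(i)\,w_2(i,j),$$ and $v_1(i)\mid r_1(i-1,j)s_2'(i-1,j)$; $v_2(j)\mid r_2(i,j-1)s_1'(i,j-1)$; $v_4(i,j)\mid \gcd\big(r_1(i-1,j)s_2'(i-1,j),\ r_2(i,j-1)s_1'(i,j-1)\big)$; $u_2(i,j)\mid \gcd\big(s_1(i,j)s_2'(i,j),\ r_1(i-1,j)s_2'(i-1,j)\big)$; $w_2(i,j)\mid \gcd\big(s_2(i,j)s_1'(i,j),\ r_2(i,j-1)s_1'(i,j-1)\big)$.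
   Context: $N$ is the shift operator in $n$: $NF(n,i,j)=F(n+1,i,j)$, and $a_0(n),\dots,a_r(n)$ are polynomials in $n$. $\Delta_x$ denotes the forward difference operator in the variable $x$: $\Delta_x G=G|_{x\to x+1}-G$. For polynomials $a,b$, $\gcd(a,b)$ denotes their monic greatest common divisor. *)

(* Defs.v *)
From HB Require Import structures.
From mathcomp Require Import all_boot all_order all_algebra.

Set Implicit Arguments.
Unset Strict Implicit.
Unset Printing Implicit Defensive.

Import GRing.Theory.
Local Open Scope ring_scope.

(* K[i, j] is {poly {poly K}} with the conventions of polyXY: i is the outer   *)
(* variable 'X and j the inner variable 'Y = 'X%:P, so that p^:P is p(i),      *)
(* p%:P is p(j) and poly_XaY p is p(i + j).                                    *)
Notation bipoly K := {poly {poly K}}.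
Notation birat K := {fraction {poly {poly K}}}.

Notation tofrac := FracField.tofrac (only parsing).

(* p(i + a, j + b) *)
Definition shift_ij (K : fieldType) (a b : int) (p : bipoly K) : bipoly K :=
  map_poly (comp_poly ('X + b%:~R)) p \Po ('X + a%:~R).

(* Divisibility in K[i, j]. The polydiv relation %| is not used: on            *)
(* {poly {poly K}} it is pseudo-divisibility, i.e. divisibility in K(j)[i].    *)
Definition divides (K : fieldType) (p q : bipoly K) : Prop :=
  exists u : bipoly K, q = u * p.

(* The gcd is normalised to be monic for the lexicographic order with i > j.   *)
Definition is_gcd (K : fieldType) (g p q : bipoly K) : Prop :=
  [/\ lead_coef g \is monic, divides g p, divides g q
    & forall u : bipoly K, divides u p -> divides u q -> divides u g].

Definition rel_prime (K : fieldType) (p q : bipoly K) : Prop := is_gcd 1 p q.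

Definition divides_gcd (K : fieldType) (u p q : bipoly K) : Prop :=
  exists2 g : bipoly K, is_gcd g p q & divides u g.

(* The units of {poly {poly K}} are the nonzero constants. *)
Definition irreducible_bipoly (K : fieldType) (p : bipoly K) : Prop :=
  [/\ p != 0, p \isn't a GRing.unit
    & forall u w : bipoly K, p = u * w ->
        (u \is a GRing.unit) || (w \is a GRing.unit)].

Definition irreducible_factor (K : fieldType) (p g : bipoly K) : Prop :=
  irreducible_bipoly p /\ divides p g.

Definition unit_step (h : int) : Prop := h \in [:: -1; 0; 1].

Definition isolated_factors (K : fieldType) (g : bipoly K) : Prop :=
  forall (p : bipoly K) (h1 h2 : int), unit_step h1 -> unit_step h2 ->
    irreducible_factor p g -> irreducible_factor (shift_ij h1 h2 p) g ->
    exists2 c : K, c != 0 & shift_ij h1 h2 p = c%:P%:P * p.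

Section HypergeometricTerms.

(* k is the field of constants, and iota embeds k(n) in K. Elements of         *)
(* k[n, i, j] are the elements of {poly {poly {poly k}}}, n being innermost.   *)
Variables (k K : fieldType) (iota : {rmorphism {fraction {poly k}} -> K}).

Definition coef_n (f : {poly k}) : K := iota (tofrac f).

Definition embed_nij (p : {poly {poly {poly k}}}) : bipoly K :=
  map_poly (map_poly coef_n) p.

Definition shift_n (p : {poly {poly {poly k}}}) : {poly {poly {poly k}}} :=
  map_poly (map_poly (comp_poly ('X + 1))) p.

(* q lies in the subfield k(n, i, j) of K(i, j). *)
Definition rational_nij (q : birat K) : Prop :=
  exists a b : {poly {poly {poly k}}},
    b != 0 /\ q = tofrac (embed_nij a) / tofrac (embed_nij b).

(* Terms live in a vector space M over K(i, j) with commuting injective shift  *)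
(* operators that are semilinear over the shifts of the variables; for         *)
(* instance M may consist of functions of (n, i, j) modulo equality outside    *)
(* the zero set of a nonzero polynomial. No shift of n is assumed on K beyond  *)
(* k(n), so N is semilinear over k(n, i, j) only.                              *)
Variable M : lmodType (birat K).

Definition shift_operators (N Si Sj : {additive M -> M}) : Prop :=
  [/\ [/\ injective N, injective Si & injective Sj],
      [/\ forall x, N (Si x) = Si (N x), forall x, N (Sj x) = Sj (N x)
        & forall x, Si (Sj x) = Sj (Si x)]
    & [/\ forall p x, N (tofrac (embed_nij p) *: x)
                      = tofrac (embed_nij (shift_n p)) *: N x,
          forall p x, Si (tofrac p *: x) = tofrac (shift_ij 1 0 p) *: Si x
        & forall p x, Sj (tofrac p *: x) = tofrac (shift_ij 0 1 p) *: Sj x]].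

Definition rational_quotient (S : M -> M) (F : M) : Prop :=
  exists2 q : birat K, rational_nij q & S F = q *: F.

Definition hypergeometric (N Si Sj : {additive M -> M}) (F : M) : Prop :=
  F != 0 /\
  [/\ rational_quotient N F, rational_quotient Si F & rational_quotient Sj F].

Definition denominator_upto (N : M -> M) (F : M) (r : nat) (d : bipoly K) :=
  d != 0 /\
  forall l : nat, (1 <= l <= r)%N ->
    exists p : bipoly K, iter l N F = (tofrac p / tofrac d) *: F.

(* The common denominator is the least one, hence unique up to a nonzero       *)
(* constant; for r = 0 it is 1.                                                *)
Definition common_denominator (N : M -> M) (F : M) (r : nat) (d : bipoly K) :=
  [/\ denominator_upto N F r d,
      forall d', denominator_upto N F r d' -> divides d d'
    & r = 0%N -> d = 1].

(* L F for L = a_0(n) + a_1(n) N + ... + a_r(n) N^r *)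
Definition apply_op (N : M -> M) (r : nat) (a : 'I_r.+1 -> {poly k}) (F : M) : M :=
  \sum_(l < r.+1) tofrac ((coef_n (a l))%:P%:P) *: iter l N F.

Definition fdiff (S : M -> M) (x : M) : M := S x - x.

End HypergeometricTerms.

(* Main.v *)
(* Dividing the telescoping equation by F and clearing denominators gives one  *)
(* polynomial identity in K[i, j]. Reading it modulo g1' and modulo g1(i+1, j) *)
(* (resp. g2' and g2(i, j+1)) yields                                           *)
(*   g1'         |  (shifts of d, f1, g1, g2, and g2') * s1 s2',               *)
(*   g1(i+1, j)  |  (shifts of d, f1, g1', g2', v, g2) * r1 s2'.               *)
(* A prime p of g1 can divide the parenthesis only if it is equal, up to a     *)
(* constant, to p(i+1, j) or to p(i+1, j-1); in characteristic 0 this forces   *)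
(* p to be a polynomial in j alone, resp. in i + j. Discarding these primes,   *)
(* the product of the others divides s1 s2', resp. r1(i-1, j) s2'(i-1, j). The *)
(* argument needs K[i, j] to be a unique factorization domain, which follows   *)
(* from Gauss's lemma applied twice.                                           *)

Require Import Defs.
From HB Require Import structures.
From mathcomp Require Import all_boot all_order all_algebra.
From mathcomp Require Import boolp ring.

Set Implicit Arguments.
Unset Strict Implicit.
Unset Printing Implicit Defensive.

Import GRing.Theory.
Local Open Scope ring_scope.

(** * Unique factorization in polynomial rings *)

(** Since [F] is nonzero, the telescoping equation is an equality of scalars, and clearing
    denominators gives a polynomial identity. In it every term but one is a multiple of g1', and the
    same holds for g1(i+1, j), g2' and g2(i, j+1); so each of these divides the remaining term
    ([telescoping_divides]). That term is the desired bound, such as s1 s2' or r1 s2', times shifts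
    of d, f1, f2, g1, g2 and their factors.

    It remains to cancel these extra factors prime by prime, with multiplicity ([prod_dvd_cancel]).
    Coprimality excludes most of them. Otherwise a shift of the prime p by a unit step divides g1 or
    g2, and (H1) makes p stable under that shift up to a unit. In characteristic 0, stability under
    a shift in i, in j, or along (1, -1) forces p to lie in K[j], K[i], or to be a polynomial in i +
    j ([shift_i_stable], [shift_j_stable], [shift_antidiag_stable]).

    So the prime factors are sorted. Those of g1' in K[j] form u1 and the others u2; those of g2' in
    K[i] form w1 and the others w2. From v, the primes in i + j are moved to v3, then those in K[i]
    to v1, then those in K[j] to v2; the rest is v4. Each class with a claimed divisibility avoids
    exactly the stabilities that would obstruct it. Sorting and gcds rest on unique factorization in
    K[i, j] ([factorial_bipoly]). *)

Section Divisibility.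
Variable R : idomainType.
Implicit Types (a b c p q x y u : R) (s : seq R).

Definition dvdr p q := exists u, q = u * p.

Definition prime_elt p :=
  [/\ p != 0, p \isn't a GRing.unit
    & forall a b, dvdr p (a * b) -> dvdr p a \/ dvdr p b].

Definition all_prime s := forall p, p \in s -> prime_elt p.

Lemma dvdr_refl p : dvdr p p.
Proof. by exists 1; rewrite mul1r. Qed.

Lemma dvdr_trans q p x : dvdr p q -> dvdr q x -> dvdr p x.
Proof. by move=> [u ->] [w ->]; exists (w * u); rewrite mulrA. Qed.

Lemma dvdr_mull p a b : dvdr p b -> dvdr p (a * b).
Proof. by move=> [u ->]; exists (a * u); rewrite mulrA. Qed.

Lemma dvdr_mulr p a b : dvdr p a -> dvdr p (a * b).
Proof. by rewrite mulrC; apply: dvdr_mull. Qed.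

Lemma dvdr_sub p a b : dvdr p a -> dvdr p b -> dvdr p (a - b).
Proof. by move=> [u ->] [w ->]; exists (u - w); rewrite mulrBl. Qed.

Lemma dvdr_unit p u : u \is a GRing.unit -> dvdr p u -> p \is a GRing.unit.
Proof. by move=> + [w uE]; rewrite uE unitrM => /andP[]. Qed.

Lemma dvdr_unitMl p u a : u \is a GRing.unit -> dvdr p (u * a) -> dvdr p a.
Proof. by move=> uU [w uaE]; exists (u^-1 * w); rewrite -mulrA -uaE mulKr. Qed.

Lemma prime_factor p a b : prime_elt p -> p = a * b ->
  a \is a GRing.unit \/ b \is a GRing.unit.
Proof.
move=> [p0 pU pP] pE.
have [] := pP a b; first by rewrite -pE; apply: dvdr_refl.
- move=> [u aE]; right; apply/unitrPr; exists u; apply: (mulfI p0).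
  by rewrite mulr1 mulrCA [p * _]mulrC -aE mulrC -pE.
move=> [u bE]; left; apply/unitrPr; exists u; apply: (mulfI p0).
by rewrite mulr1 mulrCA [p * _]mulrC -bE -pE.
Qed.

Lemma dvdr_prime_sym p q : prime_elt p -> prime_elt q -> dvdr p q -> dvdr q p.
Proof.
move=> pP qP [u qE]; have [_ pU _] := pP.
have [uU|] := prime_factor qP qE; last by rewrite (negPf pU).
by exists u^-1; rewrite qE mulKr.
Qed.

(** The head prime must divide [b]; cancelling it on both sides leaves the same situation for the
    tail, so repeated primes are counted correctly. *)
Lemma prod_dvd_cancel s a b : all_prime s ->
    (forall p, p \in s -> ~ dvdr p a) ->
  dvdr (\prod_(p <- s) p) (a * b) -> dvdr (\prod_(p <- s) p) b.
Proof.
elim: s b => [|p s IHs] b sP sa.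
  by rewrite big_nil => _; exists b; rewrite mulr1.
have [p0 _ pP] := sP p (mem_head _ _).
have ps x : x \in s -> x \in p :: s by rewrite inE orbC => ->.
rewrite big_cons => pd.
have [/(sa _ (mem_head _ _))//|[b' bE]] : dvdr p a \/ dvdr p b.
  by apply: pP; apply: dvdr_trans pd; apply: dvdr_mulr; apply: dvdr_refl.
have [x /ps/sP//|x /ps/sa//||u b'E] := IHs b'.
  case: pd => u abE; exists u; apply: (mulfI p0).
  by rewrite [RHS]mulrCA -abE bE; ring.
by exists u; rewrite bE b'E; ring.
Qed.

Lemma dvdr_mul_unit u a b : u \is a GRing.unit -> dvdr a b -> dvdr (u * a) b.
Proof. by move=> uU [w ->]; exists (w * u^-1); rewrite mulrA mulrVK. Qed.

Lemma prod_filterC (P : pred R) l :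
  \prod_(p <- l) p =
    (\prod_(p <- filter P l) p) * \prod_(p <- filter (predC P) l) p.
Proof. by rewrite (bigID P) !big_filter. Qed.

Lemma dvdr_prod_filter (P : pred R) l :
  dvdr (\prod_(p <- filter P l) p) (\prod_(p <- l) p).
Proof. by rewrite (prod_filterC P l); apply/dvdr_mulr/dvdr_refl. Qed.

Lemma all_prime_filter (P : pred R) l :
  all_prime l -> all_prime (filter P l).
Proof. by move=> lP p; rewrite mem_filter => /andP[_ /lP]. Qed.

(** Only existence is demanded: the factors are prime, not merely irreducible, so uniqueness is
    automatic. *)
Definition factorial := forall a, a != 0 -> exists u s,
  [/\ u \is a GRing.unit, all_prime s & a = u * \prod_(p <- s) p].

(** Induction on the primes of [a]: a prime that also divides [b] is pulled out of both and put into
    the gcd, any other prime is dropped from [a]. *)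
Lemma factorial_gcd a b : factorial -> a != 0 ->
  exists g, [/\ dvdr g a, dvdr g b
    & forall c, dvdr c a -> dvdr c b -> dvdr c g].
Proof.
move=> facR /facR[u [s [uU sP ->]]].
elim: s sP b => [|p s IHs] sP b.
  rewrite big_nil mulr1; exists 1.
  split; [by exists u; rewrite mulr1|by exists b; rewrite mulr1|].
  by move=> c /(dvdr_unit uU) cU _; exists c^-1; rewrite mulVr.
have [p0 _ pP] := sP p (mem_head _ _).
have {}/IHs IHs : all_prime s by move=> x xs; apply: sP; rewrite inE xs orbT.
rewrite big_cons mulrCA; set a' := u * _ in IHs *.
have [[b' ->]|pNb] := EM (dvdr p b).
  have [g [[w a'E] [y b'E] gP]] := IHs b'.
  exists (p * g); split.
  - by exists w; rewrite a'E mulrCA.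
  - by exists y; rewrite b'E -mulrA [g * p]mulrC.
  move=> c [k ka] [l lb].
  have [[c' cE]|pNc] := EM (dvdr p c).
    have [||h ->] := gP c'.
    - by exists k; apply: (mulfI p0); rewrite ka cE; ring.
    - by exists l; apply: (mulIf p0); rewrite lb cE; ring.
    by exists h; rewrite cE; ring.
  have [k' kE] : dvdr p k.
    have /pP[] // : dvdr p (k * c).
    by rewrite -ka; apply: dvdr_mulr; apply: dvdr_refl.
  have [l' lE] : dvdr p l.
    have /pP[] // : dvdr p (l * c).
    by rewrite -lb; apply: dvdr_mull; apply: dvdr_refl.
  apply: dvdr_mull; apply: gP.
    by exists k'; apply: (mulfI p0); rewrite ka kE; ring.
  by exists l'; apply: (mulIf p0); rewrite lb lE; ring.
have [g [ga gb gP]] := IHs b; exists g; split => //.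
  exact: dvdr_mull.
move=> c [k ka] cb; apply: (gP) (cb).
have [|[k' kE]|pc] := pP k c.
- by rewrite -ka; apply: dvdr_mulr; apply: dvdr_refl.
- by exists k'; apply: (mulfI p0); rewrite ka kE; ring.
- by case: pNb; apply: dvdr_trans cb.
Qed.

End Divisibility.

(** * Gauss's lemma and factoriality of R[X] *)

Section Gauss.
Variable R : idomainType.
Implicit Types (a b c p : R) (f g h : {poly R}).

Definition primitive f := forall p, prime_elt p -> ~ dvdr p%:P f.

Lemma dvdr_polyC_lead p f : dvdr p%:P f -> dvdr p (lead_coef f).
Proof.
by move=> [u ->]; exists (lead_coef u); rewrite lead_coefM lead_coefC.
Qed.

(** Gauss's lemma. If [p] divides f g, it divides one of the two leading coefficients; removing that
    leading term keeps the product divisible by [p], and induction on the sum of the sizes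
    concludes. *)
Lemma prime_polyC p : prime_elt p -> prime_elt p%:P.
Proof.
move=> [p0 pU pP]; split; first by rewrite polyC_eq0.
  by rewrite poly_unitE coefC /= (negPf pU) andbF.
move=> f g; move: {2}(size f + size g)%N (leqnn (size f + size g)) => n.
elim: n f g => [|n IHn] f g.
  rewrite leqn0 addn_eq0 size_poly_eq0 => /andP[/eqP-> _] _.
  by left; exists 0; rewrite mul0r.
have [-> _ _|f0] := eqVneq f 0; first by left; exists 0; rewrite mul0r.
have [-> _ _|g0] := eqVneq g 0; first by right; exists 0; rewrite mul0r.
pose drop h := h - lead_coef h *: 'X^((size h).-1).
have size_drop h : h != 0 -> (size (drop h) < size h)%N.
  move=> h0; rewrite -(prednK (_ : 0 < size h)%N) ?size_poly_gt0 // ltnS.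
  apply/leq_sizeP => j; rewrite leq_eqVlt => /orP[/eqP<-|hj].
    by rewrite coefB coefZ coefXn eqxx mulr1 subrr.
  rewrite coefB coefZ coefXn gtn_eqF // mulr0 subr0 nth_default //.
  by rewrite -(prednK (_ : 0 < size h)%N) ?size_poly_gt0.
have dvd_top h : dvdr p (lead_coef h) ->
    dvdr p%:P (lead_coef h *: 'X^((size h).-1)).
  move=> [e ->]; exists (e *: 'X^((size h).-1)).
  by rewrite [RHS]mulrC mul_polyC scalerA mulrC.
have dropK h : drop h + lead_coef h *: 'X^((size h).-1) = h by rewrite subrK.
have dvd_drop h : dvdr p (lead_coef h) -> dvdr p%:P (drop h) -> dvdr p%:P h.
  move=> /dvd_top[u uE] [w wE]; exists (w + u).
  by rewrite -[LHS]dropK uE wE mulrDl.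
move=> le_n pfg.
have := dvdr_polyC_lead pfg; rewrite lead_coefM => /pP[] plead.
  have [|||] := IHn (drop f) g.
  - by rewrite -ltnS (leq_trans _ le_n) // ltn_add2r size_drop.
  - by rewrite mulrBl; apply: dvdr_sub => //; apply: dvdr_mulr; apply: dvd_top.
  - by move=> pf; left; apply: dvd_drop.
  - by right.
have [|||] := IHn f (drop g).
- by rewrite -ltnS (leq_trans _ le_n) // ltn_add2l size_drop.
- by rewrite mulrBr; apply: dvdr_sub => //; apply: dvdr_mull; apply: dvd_top.
- by left.
- by move=> pg; right; apply: dvd_drop.
Qed.

Lemma primitive_dvd f g : primitive f -> dvdr g f -> primitive g.
Proof. by move=> fP gf p pP pg; apply: (fP p pP); apply: dvdr_trans gf. Qed.

Hypothesis facR : factorial R.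

Lemma primitive_dvd_scale f c g : primitive f -> c != 0 ->
  dvdr f (c%:P * g) -> dvdr f g.
Proof.
move=> fP /facR[u [s [uU sP ->]]]; rewrite polyCM -mulrA => fcg.
have {fcg} : dvdr f ((\prod_(p <- s) p)%:P * g).
  by apply: dvdr_unitMl fcg; rewrite rmorph_unit.
elim: s sP => [|p s IHs] sP; first by rewrite big_nil mul1r.
have pP := sP p (mem_head _ _); have [p0 _ _] := prime_polyC pP.
rewrite big_cons polyCM -mulrA => -[q qE].
apply: IHs => [x xs|]; first by apply: sP; rewrite inE xs orbT.
have [_ _ prP] := prime_polyC pP.
have [|[e eE]|/(fP p pP)//] := prP q f.
  by rewrite -qE; apply: dvdr_mulr; apply: dvdr_refl.
by exists e; apply: (mulfI p0); rewrite qE eE; ring.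
Qed.

(** A factorization over the fraction field descends to R[X] with the same degrees: by Gauss's lemma
    each prime of [c] can be cancelled from [g] or from [h]. *)
Lemma factor_unscale c f g h : c != 0 -> c%:P * f = g * h ->
  exists g' h', [/\ f = g' * h', size g' = size g & size h' = size h].
Proof.
move=> /facR[u [s [uU sP ->]]].
elim: s sP g h => [|p s IHs] sP g h.
  rewrite big_nil mulr1 => fE; exists ((u^-1)%:P * g), h; split => //.
    by rewrite -mulrA -fE mulrA -polyCM mulVr ?mul1r.
  by rewrite mul_polyC size_scale // invr_neq0 //; apply: contraTneq uU => ->;
     rewrite unitr0.
have pP := sP p (mem_head _ _); have [p0 _ prP] := prime_polyC pP.
have {}/IHs IHs : all_prime s by move=> x xs; apply: sP; rewrite inE xs orbT.
have size_p k : size (k * p%:P) = size k.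
  by rewrite mulrC mul_polyC size_scale // -polyC_eq0.
rewrite big_cons mulrCA polyCM -mulrA => fE.
have [|[e gE]|[e hE]] := prP g h.
- by rewrite -fE; apply: dvdr_mulr; apply: dvdr_refl.
- have [|g' [h' [-> sg sh]]] := IHs e h.
    by apply: (mulfI p0); rewrite fE gE; ring.
  by exists g', h'; rewrite gE size_p sg sh.
- have [|g' [h' [-> sg sh]]] := IHs g e.
    by apply: (mulfI p0); rewrite fE hE; ring.
  by exists g', h'; rewrite hE size_p sg sh.
Qed.

(** If [f] divides a b, take the gcd of [f] and [a] over the fraction field. By irreducibility it is
    associated to [f] or constant. In the first case [f] divides a constant multiple of [a], in the
    second Bezout shows that it divides a constant multiple of [b]; primitivity removes the
    constant. *)
Lemma primitive_irreducible_prime f : primitive f -> (1 < size f)%N ->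
    (forall g h, f = g * h -> size g = 1%N \/ size h = 1%N) ->
  prime_elt f.
Proof.
move=> fP f1 fI; have f0 : f != 0 by rewrite -size_poly_gt0 ltnW.
split=> // [|a b [e abE]]; first by rewrite poly_unitE gtn_eqF.
have /Pdiv.Idomain.dvdpP[[c q] /= c0 cE] :=
  Pdiv.Idomain.dvdp_gcdl f a.
rewrite -mul_polyC in cE.
have [q' [g' [fE sq sg]]] := factor_unscale c0 cE.
have [s1|s1] := fI _ _ fE.
  left; have : gcdp f a %= f.
    rewrite -Pdiv.Idomain.dvdp_size_eqp ?Pdiv.Idomain.dvdp_gcdl //.
    rewrite -sg fE.
    have /eqP/size_poly1P[k k0 ->] := s1.
    by rewrite mul_polyC size_scale.
  move=> /andP[_ /Pdiv.Idomain.dvdp_trans/(_ (Pdiv.Idomain.dvdp_gcdr f a))].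
  move=> /Pdiv.Idomain.dvdpP[[k w] /= k0].
  rewrite -mul_polyC => kE.
  by apply: (primitive_dvd_scale fP k0); exists w.
right; have /eqP/size_poly1P[k k0 gE] : size (gcdp f a) = 1%N by rewrite -sg.
have [[u w] /=] := Pdiv.Idomain.Bezoutp f a.
move=> /Pdiv.Idomain.eqpP[[c1 c2] /= /andP[c10 c20]].
rewrite gE -!mul_polyC -polyCM => uwE.
apply: (primitive_dvd_scale fP (mulf_neq0 c20 k0)).
exists (c1%:P * (u * b + w * e)); rewrite -uwE.
by move: abE => /(congr1 (fun x => c1%:P * w * x)) abE; ring: abE.
Qed.

(* The primes in [s] are tried one by one on [f]; the primes dividing [u] are
   those already known not to divide [f]. *)
Lemma primitive_part f : f != 0 ->
  exists c f', [/\ c != 0, primitive f' & f = c%:P * f'].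
Proof.
move=> f0; have := f0; rewrite -lead_coef_eq0 => /facR[u [s [uU sP]]].
have : forall p, prime_elt p -> dvdr p u -> ~ dvdr p%:P f.
  by move=> p [_ pU _] /(dvdr_unit uU); rewrite (negPf pU).
elim: s sP f u f0 {uU} => [|x s IHs] sP f u f0 uP.
  rewrite big_nil mulr1 => lf; exists 1, f; split; rewrite ?oner_eq0 ?mul1r //.
  move=> p pP pf; apply: uP (pf) => //.
  by rewrite -lf; apply: dvdr_polyC_lead.
have xP := sP x (mem_head _ _); have [x0 _ _] := xP.
have {}/IHs IHs : all_prime s by move=> y ys; apply: sP; rewrite inE ys orbT.
rewrite big_cons => lf.
have [[f' fE]|xNf] := EM (dvdr x%:P f).
  have [|p pP pu pf'||c [f'' [c0 f''P f'E]]] := IHs f' u.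
  - by apply: contraNneq f0 => f'0; rewrite fE f'0 mul0r.
  - by apply: (uP p pP pu); rewrite fE; apply: dvdr_mulr.
  - apply: (mulIf x0); rewrite -[in LHS](lead_coefC x) -lead_coefM -fE lf.
    by rewrite -mulrA [x * _]mulrC.
  exists (c * x), f''; split; rewrite ?mulf_neq0 //.
  by rewrite fE f'E polyCM mulrAC.
apply: (IHs f (u * x)) => //; last by rewrite lf mulrA.
move=> p pP pux pf; have [_ _ prP] := pP.
have [pu|px] := prP _ _ pux; first exact: uP pf.
apply: xNf; apply: dvdr_trans pf.
have [e ->] := dvdr_prime_sym pP xP px.
by exists e%:P; rewrite polyCM.
Qed.

(** Induction on the degree: factors of a primitive polynomial are primitive, and a primitive
    constant is a unit, having no prime divisor. *)
Lemma primitive_factorization f : f != 0 -> primitive f ->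
  exists u s, [/\ u \is a GRing.unit, all_prime s & f = u * \prod_(p <- s) p].
Proof.
move: {2}(size f) (leqnn (size f)) => n.
elim: n f => [|n IHn] f; first by rewrite leqn0 size_poly_eq0 => ->.
move=> le_n f0 fP.
have [/size1_polyC fE|f1] := leqP (size f) 1.
  exists f, [::]; split=> //; last by rewrite big_nil mulr1.
  have c0 : f`_0 != 0 by rewrite -polyC_eq0 -fE.
  have [u [[|p s] [uU sP cE]]] := facR c0.
    by rewrite fE rmorph_unit // cE big_nil mulr1.
  case: (fP p); first by apply: sP; rewrite mem_head.
  by rewrite fE cE big_cons mulrCA polyCM; apply: dvdr_mulr; apply: dvdr_refl.
have [[g [h [fE g1 h1]]]|fI] :=
  EM (exists g h, [/\ f = g * h, size g != 1%N & size h != 1%N]); last first.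
  exists 1, [:: f]; rewrite unitr1 big_seq1 mul1r; split=> // p.
  rewrite inE => /eqP->; apply: primitive_irreducible_prime => // g h fE.
  have [->|g1] := eqVneq (size g) 1%N; first by left.
  have [->|h1] := eqVneq (size h) 1%N; first by right.
  by case: fI; exists g, h.
have [g0 h0] : g != 0 /\ h != 0 by apply/andP; rewrite -negb_or -mulf_eq0 -fE.
have g2 : (1 < size g)%N by rewrite ltn_neqAle eq_sym g1 size_poly_gt0.
have h2 : (1 < size h)%N by rewrite ltn_neqAle eq_sym h1 size_poly_gt0.
have sfE : (size f).+1 = (size g + size h)%N.
  by rewrite fE size_mul // prednK // addn_gt0 ltnW.
have [|||u [s [uU sP gE]]] := IHn g.
- by rewrite -ltnS (leq_trans _ le_n) // -ltnS sfE -addn2 leq_add2l.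
- by [].
- by apply: primitive_dvd fP _; exists h; rewrite mulrC.
have [|||w [t [wU tP hE]]] := IHn h.
- by rewrite -ltnS (leq_trans _ le_n) // -ltnS sfE -addn2 addnC leq_add2r.
- by [].
- by apply: primitive_dvd fP _; exists g.
exists (u * w), (s ++ t); split; first by rewrite unitrM uU.
  by move=> p; rewrite mem_cat => /orP[/sP|/tP].
by rewrite fE gE hE big_cat /= mulrACA.
Qed.

Theorem factorial_poly : factorial {poly R}.
Proof.
move=> f f0; have [c [f' [c0 f'P fE]]] := primitive_part f0.
have [|u [s [uU sP f'E]]] := primitive_factorization _ f'P.
  by apply: contraNneq f0 => f'0; rewrite fE f'0 mulr0.
have [w [t [wU tP cE]]] := facR c0.
exists (w%:P * u), ([seq p%:P | p <- t] ++ s); split.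
- by rewrite unitrM uU rmorph_unit.
- move=> p; rewrite mem_cat => /orP[/mapP[q /tP qP ->]|/sP//].
  exact: prime_polyC.
- by rewrite fE f'E cE polyCM rmorph_prod big_cat big_map /= mulrACA.
Qed.

End Gauss.

Lemma factorial_field (K : fieldType) : factorial K.
Proof.
move=> x x0; exists x, [::]; split; by rewrite ?unitfE // big_nil mulr1.
Qed.

Lemma factorial_bipoly (K : fieldType) : factorial {poly {poly K}}.
Proof. by do 2!apply: factorial_poly; apply: factorial_field. Qed.

(** * Primes stable under a shift *)

Section ShiftIJ.
Variable K : fieldType.
Implicit Types (p q : bipoly K) (a b : int).

Lemma shift_ij_zmod_morphism a b : zmod_morphism (@shift_ij K a b).
Proof. by move=> p q; rewrite /shift_ij !rmorphB. Qed.

Lemma shift_ij_monoid_morphism a b : monoid_morphism (@shift_ij K a b).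
Proof. by split=> [|p q]; rewrite /shift_ij ?rmorph1 ?rmorphM. Qed.

HB.instance Definition _ a b := GRing.isZmodMorphism.Build (bipoly K) (bipoly K)
  (@shift_ij K a b) (shift_ij_zmod_morphism a b).
HB.instance Definition _ a b := GRing.isMonoidMorphism.Build (bipoly K) (bipoly K)
  (@shift_ij K a b) (shift_ij_monoid_morphism a b).

Lemma comp_polyXDint (R : comNzRingType) (a b : int) :
  ('X + a%:~R) \Po ('X + b%:~R) = 'X + (a + b)%:~R :> {poly R}.
Proof.
rewrite comp_polyD comp_polyX -[a%:~R](rmorph_int polyC a) comp_polyC.
by rewrite rmorph_int intrD -addrA [b%:~R + _]addrC.
Qed.

Lemma shift_ij00 p : shift_ij 0 0 p = p.
Proof.
rewrite /shift_ij !addr0 comp_polyXr map_poly_id // => q _.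
by rewrite comp_polyXr.
Qed.

Lemma shift_ijD a b a' b' p :
  shift_ij a b (shift_ij a' b' p) = shift_ij (a + a') (b + b') p.
Proof.
have XE : map_poly (comp_poly ('X + b%:~R)) ('X + a'%:~R) = 'X + a'%:~R :> bipoly K.
  by rewrite rmorphD rmorph_int /= map_polyX.
rewrite /shift_ij map_comp_poly XE -comp_polyA -map_poly_comp comp_polyXDint.
rewrite [a' + a]addrC; congr (_ \Po _).
by apply: eq_map_poly => q /=; rewrite -comp_polyA comp_polyXDint [b' + b]addrC.
Qed.

End ShiftIJ.

Section StablePrimes.

Definition char0 (R : nzRingType) := forall n : nat, n.+1%:R != 0 :> R.

Lemma intr_neq0 (R : nzRingType) (a : int) : char0 R -> a != 0 -> a%:~R != 0 :> R.
Proof.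
move=> R0; case: a => [[|n]|n] // _; first exact: R0.
by rewrite NegzE mulrNz oppr_eq0; apply: R0.
Qed.

(* Comparing leading coefficients gives c = 1, so q takes the value q(0) at all
   multiples of a. *)
Lemma comp_polyDint_stable (R : idomainType) (q : {poly R}) (a : int) (c : R) :
    char0 R -> a != 0 -> q \Po ('X + a%:~R) = c%:P * q ->
  q = (q`_0)%:P.
Proof.
move=> R0 /(intr_neq0 R0) a0 qE.
have [->|q0] := eqVneq q 0; first by rewrite coef0.
have XaE : 'X + a%:~R = 'X + (a%:~R)%:P :> {poly R} by rewrite rmorph_int.
have cE : c = 1.
  apply: (mulIf (_ : lead_coef q != 0)); first by rewrite lead_coef_eq0.
  rewrite mul1r -{1}[c]lead_coefC -lead_coefM -qE XaE lead_coef_comp.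
    by rewrite lead_coefXaddC expr1n mulr1.
  by rewrite size_XaddC.
have per x : q.[x + a%:~R] = q.[x].
  have := congr1 (horner^~ x) qE.
  by rewrite cE mul1r horner_comp XaE !hornerE.
have per_n n : q.[a%:~R *+ n] = q.[0].
  by elim: n => [|n IHn]; rewrite ?mulr0n // mulrSr per.
rewrite -horner_coef0; apply/eqP; rewrite -subr_eq0; apply/negPn/negP => D0.
pose rs : seq R := [seq a%:~R *+ i | i <- iota 0 (size (q - q.[0]%:P))].
suff: (size rs < size (q - q.[0]%:P)%R)%N by rewrite size_map size_iota ltnn.
apply: max_poly_roots => //.
  by apply/allP => x /mapP[n _ ->]; rewrite rootE !hornerE per_n subrr.
rewrite map_inj_uniq ?iota_uniq // => m n.
wlog le_mn: m n / (m <= n)%N.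
  by move=> wl; case: (leqP m n) => [/wl//|/ltnW/wl + /esym E] => /(_ E).
move=> /esym/eqP; rewrite -subr_eq0 -mulrnBr // -mulr_natr mulf_eq0 (negPf a0) /=.
by case Dk: (n - m)%N => [|k]; rewrite ?(negPf (R0 k)) // => _; apply/eqP;
   rewrite eqn_leq le_mn -subn_eq0 Dk.
Qed.

Lemma char0_poly (R : nzRingType) : char0 R -> char0 {poly R}.
Proof. by move=> R0 n; rewrite -polyC_natr polyC_eq0; apply: R0. Qed.

Variable K : fieldType.
Implicit Types (p q u : bipoly K) (a b : int).
Hypothesis K0 : char0 K.

Lemma unit_bipolyP u : u \is a GRing.unit -> exists2 c : K, c != 0 & u = c%:P%:P.
Proof.
rewrite poly_unitE => /andP[/eqP/eq_leq/size1_polyC uE].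
rewrite uE coefC /= poly_unitE => /andP[/eqP/eq_leq/size1_polyC cE].
by rewrite cE coefC /= unitfE => c0; exists u`_0`_0; rewrite // -cE -uE.
Qed.

Lemma shift_i_stable a p u : a != 0 -> u \is a GRing.unit ->
  shift_ij a 0 p = u * p -> exists q : {poly K}, p = q%:P.
Proof.
move=> a0 /unit_bipolyP[c _ ->] pE; exists p`_0.
apply: (comp_polyDint_stable (char0_poly K0) a0).
move: pE; rewrite /shift_ij addr0 map_poly_id; first exact.
by move=> q _; rewrite comp_polyXr.
Qed.

Lemma shift_j_stable b p u : b != 0 -> u \is a GRing.unit ->
  shift_ij 0 b p = u * p -> exists q : {poly K}, p = q^:P.
Proof.
move=> b0 /unit_bipolyP[c _ ->]; rewrite /shift_ij addr0 comp_polyXr => pE.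
(* The shift in j acts on each coefficient of p separately, so every coefficient is constant in j
   and equals its value at 0. *)
exists (\poly_(i < size p) p`_i`_0); apply/polyP => i.
rewrite coef_map coef_poly /=; case: ltnP => [_|/(nth_default 0)->]; last first.
  by rewrite polyC0.
apply: (comp_polyDint_stable (c := c) K0 b0).
by have := congr1 (fun f : bipoly K => f`_i) pE; rewrite coef_map coefCM.
Qed.

(* The substitution i := i - j turns the shift (-a, a) into the shift (0, a). *)
Lemma shift_antidiag_stable a p u : a != 0 -> u \is a GRing.unit ->
  shift_ij (- a) a p = u * p -> exists q : {poly K}, p = poly_XaY q.
Proof.
move=> a0 uU pE; have [c _ uE] := unit_bipolyP uU.
have [|q qE] := @shift_j_stable a (p \Po ('X - 'Y)) u a0 uU.
  transitivity (shift_ij (- a) a p \Po ('X - 'Y)); last first.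
    by rewrite pE comp_polyM uE comp_polyC.
  rewrite /shift_ij addr0 comp_polyXr map_comp_poly -comp_polyA rmorphB /=.
  rewrite map_polyX map_polyC /= comp_polyX; congr (_ \Po _).
  rewrite comp_polyD comp_polyX -[(- a)%:~R](rmorph_int polyC) comp_polyC.
  by rewrite rmorph_int polyCD opprD addrA rmorph_int mulrNz.
exists q; rewrite /poly_XaY -qE -comp_polyA comp_polyB comp_polyX comp_polyC.
by rewrite addrK comp_polyXr.
Qed.

End StablePrimes.

(** * Denominators in the telescoping equation *)

(* The shifts are abstract so that the results also apply with i and j exchanged. *)
Section TwoShifts.
Variables (R : idomainType) (sh : int -> int -> {rmorphism R -> R}).
Hypothesis sh00 : forall x, sh 0 0 x = x.
Hypothesis shD : forall a b a' b' x,
  sh a b (sh a' b' x) = sh (a + a') (b + b') x.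
Implicit Types (a b : int) (p x y z : R) (l : seq R).

Lemma shK a b : cancel (sh a b) (sh (- a) (- b)).
Proof. by move=> x; rewrite shD !addNr sh00. Qed.

Lemma shVK a b : cancel (sh (- a) (- b)) (sh a b).
Proof. by move=> x; rewrite shD !subrr sh00. Qed.

Lemma dvdr_sh a b x y : dvdr x y -> dvdr (sh a b x) (sh a b y).
Proof. by move=> [u ->]; exists (sh a b u); rewrite rmorphM. Qed.

Lemma dvdr_shV a b x y : dvdr x (sh a b y) -> dvdr (sh (- a) (- b) x) y.
Proof. by move=> /(dvdr_sh (- a) (- b)); rewrite shK. Qed.

Lemma prime_sh a b p : prime_elt p -> prime_elt (sh a b p).
Proof.
move=> [p0 pU prP]; have shU q : sh a b q \is a GRing.unit -> q \is a GRing.unit.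
  by move=> /(rmorph_unit (sh (- a) (- b))); rewrite shK.
split; first by rewrite -(can_eq (shVK a b)) rmorph0 shK.
  by apply: contra pU => /shU.
move=> x y /(dvdr_sh (- a) (- b)); rewrite shK rmorphM => /prP[] pd; [left|right].
  by move: (dvdr_sh a b pd); rewrite shVK.
by move: (dvdr_sh a b pd); rewrite shVK.
Qed.

Definition coprimer x y :=
  forall c, dvdr c x -> dvdr c y -> c \is a GRing.unit.

Lemma coprimer_sym x y : coprimer x y -> coprimer y x.
Proof. by move=> xy c cy cx; apply: xy. Qed.

Lemma coprimer_prime p x y : prime_elt p -> coprimer x y -> dvdr p x -> ~ dvdr p y.
Proof. by move=> [_ pU _] xy px py; move: pU; rewrite (xy p px py). Qed.

Lemma coprimer_shV a b x y : coprimer (sh (- a) (- b) x) y -> coprimer x (sh a b y).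
Proof.
move=> xy c /(dvdr_sh (- a) (- b)) cx /dvdr_shV cy.
by rewrite -(shVK a b c) rmorph_unit // xy.
Qed.

Definition stable a b p := exists2 u, u \is a GRing.unit & sh a b p = u * p.

Lemma stable_dvd a b p x : stable a b p -> dvdr (sh a b p) x -> dvdr p x.
Proof. by move=> [u _ ->] [w ->]; exists (w * u); rewrite mulrA. Qed.

Definition isolated g := forall p h1 h2, unit_step h1 -> unit_step h2 ->
  prime_elt p -> dvdr p g -> dvdr (sh h1 h2 p) g -> stable h1 h2 p.

Variables d f g1' g2' v s t : R.
Let g1 := g1' * v.
Let g2 := g2' * v.
Hypotheses (g1_isol : isolated g1) (g2_isol : isolated g2).
Hypothesis g1d : forall h1 h2, unit_step h1 -> unit_step h2 ->
  coprimer g1 (sh h1 h2 d).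
Hypothesis fg1 : coprimer f g1.
Hypothesis g1v : coprimer g1' v.
Hypothesis g12 : forall h1 h2, unit_step h1 -> unit_step h2 ->
  coprimer (sh h1 h2 g1') g2'.

(** Here [s] stands for s1 s2'. For a prime of g1', the only factor not excluded by coprimality or
    by isolation together with [g1v] is g1(i+1, j), which would make the prime stable under (-1,
    0). *)
Lemma cofactor_dvd_denominators l :
    dvdr g1' (sh 1 0 d * sh 0 1 d * f * g2' * sh 1 0 g1 * sh 0 1 g2 * s) ->
    all_prime l -> dvdr (\prod_(p <- l) p) g1' ->
    (forall p, p \in l -> ~ stable (-1) 0 p) ->
  dvdr (\prod_(p <- l) p) s.
Proof.
move=> g1'_dvd lP lg1' lS; have := dvdr_trans lg1' g1'_dvd.
apply: prod_dvd_cancel => // p pl.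
have pP := lP p pl; have [_ _ prP] := pP.
have pg1' : dvdr p g1'.
  by apply: dvdr_trans lg1'; rewrite (big_rem p) //=; apply/dvdr_mulr/dvdr_refl.
have pg1 : dvdr p g1 by apply: dvdr_mulr.
have pNv := coprimer_prime pP g1v pg1'.
have pNg2' h1 h2 :
    unit_step (- h1) -> unit_step (- h2) -> ~ dvdr p (sh h1 h2 g2').
  move=> h1S h2S.
  by apply: coprimer_prime (pg1') => //; apply/coprimer_shV/g12.
move=> /prP[|pg2]; last first.
  (* If p(i, j-1) divides v, both p and p(i, j-1) divide g1, so they are associated and p itself
     divides v, against [g1v]. *)
  have [|/dvdr_shV] : dvdr p (sh 0 1 g2') \/ dvdr p (sh 0 1 v).
  - by apply: prP; rewrite -rmorphM.
  - exact: pNg2'.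
  move=> pv; apply: pNv; apply: stable_dvd (pv).
  by apply: g1_isol => //; apply: dvdr_mull.
move=> /prP[|/dvdr_shV pg1s]; last first.
  by apply: (lS p pl); apply: g1_isol.
move=> /prP[|]; last by have := pNg2' 0 0; rewrite sh00; apply.
move=> /prP[|]; last exact: coprimer_prime (coprimer_sym fg1) pg1.
by move=> /prP[]; apply: coprimer_prime (pg1) => //; apply: g1d.
Qed.

Hypothesis g1_dvd : dvdr (sh 1 0 g1)
  (d * sh 0 1 d * sh 1 0 f * sh 0 1 g2 * g1' * g2' * v * t).

(** Here [t] stands for r1 s2'. The conditions on g2' and g2 stay hypotheses because they hold for
    different reasons for primes of g1' and of v. *)
Lemma dvd_shifted_numerators l :
    all_prime l -> dvdr (\prod_(p <- l) p) g1 ->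
    (forall p, p \in l -> ~ stable 1 0 p) ->
    (forall p, p \in l -> ~ dvdr p (sh (-1) 0 g2')) ->
    (forall p, p \in l -> ~ dvdr p (sh (-1) 1 g2)) ->
  dvdr (\prod_(p <- l) p) (sh (-1) 0 t).
Proof.
move=> lP lg1 lS lg2' lg2.
have := dvdr_sh (-1) 0 g1_dvd; rewrite shD addNr addr0 sh00 => /(dvdr_trans lg1).
rewrite !(rmorphM (sh (-1) 0)) !shD addNr !addr0 !add0r sh00.
apply: prod_dvd_cancel => // p pl.
have pP := lP p pl; have [_ _ prP] := pP.
have pg1 : dvdr p g1.
  by apply: dvdr_trans lg1; rewrite (big_rem p) //=; apply/dvdr_mulr/dvdr_refl.
have pNg1 : ~ dvdr p (sh (-1) 0 g1).
  by move=> /dvdr_shV pg1s; apply: (lS p pl); apply: g1_isol.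
move=> /prP[|pv]; last by apply: pNg1; rewrite rmorphM; apply: dvdr_mull.
move=> /prP[|]; last exact: lg2'.
move=> /prP[|pg1']; last by apply: pNg1; rewrite rmorphM; apply: dvdr_mulr.
move=> /prP[|]; last exact: lg2.
move=> /prP[|]; last exact: coprimer_prime (coprimer_sym fg1) pg1.
by move=> /prP[]; apply: coprimer_prime (pg1) => //; apply: g1d.
Qed.

Lemma cofactor_dvd_numerators l :
    all_prime l -> dvdr (\prod_(p <- l) p) g1' ->
    (forall p, p \in l -> ~ stable 1 0 p) ->
  dvdr (\prod_(p <- l) p) (sh (-1) 0 t).
Proof.
move=> lP lg1' lS.
have pg1' p : p \in l -> dvdr p g1'.
  by move=> pl; apply: dvdr_trans lg1'; rewrite (big_rem p) //=;
     apply/dvdr_mulr/dvdr_refl.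
have pNg2' p h1 h2 : p \in l ->
    unit_step (- h1) -> unit_step (- h2) -> ~ dvdr p (sh h1 h2 g2').
  move=> pl h1S h2S; have pP := lP p pl.
  by apply: coprimer_prime (pg1' p pl) => //; apply/coprimer_shV/g12.
apply: dvd_shifted_numerators => // [|p pl|p pl]; first exact: dvdr_mulr.
  exact: pNg2'.
have pP := lP p pl; have [_ _ prP] := pP.
rewrite rmorphM => /prP[|/dvdr_shV pv]; first exact: pNg2'.
apply: (coprimer_prime pP g1v (pg1' p pl)); apply: stable_dvd (pv).
by apply: g1_isol => //; [apply/dvdr_mulr/pg1'|apply: dvdr_mull].
Qed.

(** A prime of v divides both g1 and g2, so isolation of g2 applies as well. The factor g2(i-1, j+1)
    is what brings in the diagonal shift (1, -1), hence polynomials in i + j. *)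
Lemma common_dvd_numerators l :
    all_prime l -> dvdr (\prod_(p <- l) p) v ->
    (forall p, p \in l -> ~ stable 1 0 p) ->
    (forall p, p \in l -> ~ stable 1 (-1) p) ->
  dvdr (\prod_(p <- l) p) (sh (-1) 0 t).
Proof.
move=> lP lv lS lSd.
have pv p : p \in l -> dvdr p v.
  by move=> pl; apply: dvdr_trans lv; rewrite (big_rem p) //=;
     apply/dvdr_mulr/dvdr_refl.
apply: dvd_shifted_numerators => // [|p pl|p pl]; first exact: dvdr_mull.
  move=> /dvdr_shV pg2'; apply: (lS p pl); have pP := lP p pl.
  by apply: g2_isol => //; [apply/dvdr_mull/pv|apply: dvdr_mulr].
move=> /dvdr_shV pg2; apply: (lSd p pl); have pP := lP p pl.
by apply: g2_isol => //; apply/dvdr_mull/pv.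
Qed.

End TwoShifts.

(** The common factor [s] of s1 and s2 enters the common denominator once, which is why the
    cofactors s1' and s2' appear in the bounds. *)
Lemma clear_denominators (L : fieldType)
    (P d di dj f1 f1i f2 f2j g1' g2' v g1i g2j r1 r2 s s1' s2' : L) :
    d != 0 -> di != 0 -> dj != 0 -> g1' != 0 -> g2' != 0 -> v != 0 ->
    g1i != 0 -> g2j != 0 -> s != 0 -> s1' != 0 -> s2' != 0 ->
    P / d = 1 / di * (f1i / g1i) * (r1 / (s1' * s)) - 1 / d * (f1 / (g1' * v))
      + (1 / dj * (f2j / g2j) * (r2 / (s2' * s)) - 1 / d * (f2 / (g2' * v))) ->
  P * di * dj * g1i * g2j * g1' * g2' * v * s * s1' * s2' =
    d * dj * f1i * g2j * g1' * g2' * v * (r1 * s2')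
    - di * dj * f1 * g2' * g1i * g2j * (s1' * s * s2')
    + d * di * f2j * g1i * g1' * g2' * v * (r2 * s1')
    - di * dj * f2 * g1' * g1i * g2j * (s2' * s * s1').
Proof.
move=> d0 di0 dj0 g10 g20 v0 g1i0 g2j0 s0 s10 s20 PE.
have -> : P = d * (P / d) by field.
by rewrite PE; field; rewrite d0 di0 dj0 g10 g20 v0 g1i0 g2j0 s0 s10 s20.
Qed.
Lemma prod_image (A B : comNzRingType) (phi : {rmorphism A -> B}) (l : seq B) :
    (forall p, p \in l -> exists q, p = phi q) ->
  exists q, \prod_(p <- l) p = phi q.
Proof.
move=> lP; rewrite big_seq; elim/big_ind: _ => [|_ _ [q ->] [r ->]|p /lP//].
  by exists 1; rewrite rmorph1.
by exists (q * r); rewrite rmorphM.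
Qed.

(** * Bivariate polynomials as an instance of the abstract setting *)

Section Bipoly.
Variable K : fieldType.
Implicit Types (p q g : bipoly K).

Definition shift_ij_rmorphism (h1 h2 : int) : {rmorphism bipoly K -> bipoly K} :=
  @shift_ij K h1 h2.

Lemma prime_irreducible p : prime_elt p -> irreducible_bipoly p.
Proof.
move=> pP; have [p0 pU _] := pP; split=> // u w /(prime_factor pP) uw.
by apply/orP.
Qed.

Lemma rel_prime_coprimer p q : rel_prime p q -> coprimer p q.
Proof. by move=> [_ _ _ pq] c cp cq; apply: dvdr_unit (unitr1 _) (pq c cp cq). Qed.

Lemma isolated_factors_isolated g :
  isolated_factors g -> isolated (shift_ij_rmorphism) g.
Proof.
move=> gP p h1 h2 h1S h2S pP pg psg.
have sP : prime_elt (shift_ij h1 h2 p).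
  exact: (@prime_sh _ (shift_ij_rmorphism) (@shift_ij00 K) (@shift_ijD K)).
have [||c c0 pE] := gP p h1 h2 h1S h2S.
- by split=> //; apply: prime_irreducible.
- by split=> //; apply: prime_irreducible.
by exists c%:P%:P; rewrite ?rmorph_unit ?unitfE.
Qed.

Lemma is_gcd_exists p q : p != 0 -> exists g, is_gcd g p q.
Proof.
move=> p0; have [g [[u pE] [w qE] gP]] := factorial_gcd q (@factorial_bipoly K) p0.
have g0 : lead_coef (lead_coef g) != 0.
  by rewrite !lead_coef_eq0; apply: contraNneq p0 => g0; rewrite pE g0 mulr0.
set c := lead_coef _ in g0.
have cK : c%:P%:P * (c^-1)%:P%:P = 1 :> bipoly K by rewrite -!polyCM divff.
exists ((c^-1)%:P%:P * g); split.
- by rewrite monicE !lead_coefM !lead_coefC mulVf.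
- by exists (u * c%:P%:P); rewrite mulrA -[u * _ * _]mulrA cK mulr1.
- by exists (w * c%:P%:P); rewrite mulrA -[w * _ * _]mulrA cK mulr1.
by move=> h hp hq; apply/dvdr_mull/gP.
Qed.

Lemma divides_gcdI u p q : p != 0 -> dvdr u p -> dvdr u q -> divides_gcd u p q.
Proof.
move=> /is_gcd_exists-/(_ q)[g gE] up uq; exists g => //.
by have [_ _ _] := gE; apply.
Qed.

Lemma shift_ij_neq0 h1 h2 p : p != 0 -> shift_ij_rmorphism h1 h2 p != 0.
Proof.
apply: contra_neq => /(congr1 (shift_ij_rmorphism (- h1) (- h2))).
by rewrite rmorph0 (@shK _ _ (@shift_ij00 K) (@shift_ijD K)).
Qed.

Lemma prime_neq_univariate p (q q' : {poly K}) :
  prime_elt p -> p = q^:P -> p = q'%:P -> False.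
Proof.
move=> [p0 /negP pU _] pE pE'; apply: pU.
have /(congr1 (fun g : bipoly K => g`_0)) := pE.
rewrite {1}pE' coefC coef_map /= => q'E; move: p0.
rewrite pE' q'E !polyC_eq0 => q0.
by rewrite !rmorph_unit // unitfE.
Qed.

End Bipoly.

(** * From the telescoping equation to a polynomial identity *)

Section Telescoping.
Variables (K : fieldType) (M : lmodType (birat K)).
Implicit Types (S : {additive M -> M}) (sg : bipoly K -> bipoly K).

(** Semilinearity is available for polynomial scalars only; fractions are reached by multiplying by
    the image of the denominator. *)
Lemma semilinear_quotient S sg F x y r s :
    (forall p z, S (tofrac p *: z) = tofrac (sg p) *: S z) ->
    y != 0 -> sg y != 0 -> S F = (tofrac r / tofrac s) *: F ->
  S ((tofrac x / tofrac y) *: F)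
    = (tofrac (sg x) / tofrac (sg y) * (tofrac r / tofrac s)) *: F.
Proof.
move=> SZ y0 sy0 SF.
apply: (scalerI (_ : tofrac (sg y) != 0)); first by rewrite tofrac_eq0.
rewrite -SZ scalerA mulrC divfK ?tofrac_eq0 // SZ SF !scalerA; congr (_ *: _).
by rewrite [RHS]mulrA [X in _ = X * _]mulrC divfK // tofrac_eq0.
Qed.

Lemma telescoping_identity (Si Sj : {additive M -> M})
    (si sj : {rmorphism bipoly K -> bipoly K}) (F : M)
    (P d f1 f2 g1' g2' v r1 r2 s s1' s2' : bipoly K) :
    (forall p z, Si (tofrac p *: z) = tofrac (si p) *: Si z) ->
    (forall p z, Sj (tofrac p *: z) = tofrac (sj p) *: Sj z) ->
    (forall p, p != 0 -> si p != 0) -> (forall p, p != 0 -> sj p != 0) ->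
    F != 0 -> d != 0 -> g1' * v != 0 -> g2' * v != 0 ->
    s1' * s != 0 -> s2' * s != 0 ->
    Si F = (tofrac r1 / tofrac (s1' * s)) *: F ->
    Sj F = (tofrac r2 / tofrac (s2' * s)) *: F ->
    (tofrac P / tofrac d) *: F =
      fdiff Si ((1 / tofrac d * (tofrac f1 / tofrac (g1' * v))) *: F)
      + fdiff Sj ((1 / tofrac d * (tofrac f2 / tofrac (g2' * v))) *: F) ->
  P * si d * sj d * si (g1' * v) * sj (g2' * v) * g1' * g2' * v * s * s1' * s2' =
    d * sj d * si f1 * sj (g2' * v) * g1' * g2' * v * (r1 * s2')
    - si d * sj d * f1 * g2' * si (g1' * v) * sj (g2' * v) * (s1' * s * s2')
    + d * si d * sj f2 * si (g1' * v) * g1' * g2' * v * (r2 * s1')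
    - si d * sj d * f2 * g1' * si (g1' * v) * sj (g2' * v) * (s2' * s * s1').
Proof.
move=> SiZ SjZ si0 sj0 F0 d0 g1v0 g2v0 s1s0 s2s0 SiF SjF.
have [g1'0 v0] : g1' != 0 /\ v != 0 by apply/andP; rewrite -negb_or -mulf_eq0.
have g2'0 : g2' != 0 by apply: contraNneq g2v0 => ->; rewrite mul0r.
have [s1'0 s0] : s1' != 0 /\ s != 0 by apply/andP; rewrite -negb_or -mulf_eq0.
have s2'0 : s2' != 0 by apply: contraNneq s2s0 => ->; rewrite mul0r.
have RE x f g : 1 / tofrac x * (tofrac f / tofrac g) = tofrac f / tofrac (x * g)
    :> birat K.
  by rewrite tofracM invfM mulrCA mul1r.
rewrite /fdiff !RE.
rewrite (semilinear_quotient _ SiZ _ _ SiF) ?(semilinear_quotient _ SjZ _ _ SjF);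
  rewrite ?si0 ?sj0 ?mulf_neq0 //.
rewrite -!scalerBl -scalerDl => /eqP.
rewrite -subr_eq0 -scalerBl scaler_eq0 (negPf F0) orbF subr_eq0 => /eqP PE.
apply/eqP; rewrite -tofrac_eq; apply/eqP.
rewrite !(tofracB, tofracD, tofracM (R := bipoly K)).
apply: clear_denominators; rewrite ?tofrac_eq0 ?si0 ?sj0 //.
rewrite PE (rmorphM si d) (rmorphM sj d).
by rewrite -!(RE d) -(RE (si d)) -(RE (sj d)) !tofracM.
Qed.

Lemma apply_op_quotient (k : fieldType) (iota : {rmorphism {fraction {poly k}} -> K})
    (N : {additive M -> M}) (F : M) (r : nat) (d : bipoly K)
    (a : 'I_r.+1 -> {poly k}) :
    denominator_upto N F r d ->
  exists P : bipoly K, apply_op iota N a F = (tofrac P / tofrac d) *: F.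
Proof.
move=> [d0 dP]; rewrite /apply_op.
elim/big_ind: _ => [|x y [P ->] [Q ->]|[[|l] lr] _].
- by exists 0; rewrite tofrac0 mul0r scale0r.
- by exists (P + Q); rewrite tofracD mulrDl scalerDl.
(* The term l = 0 lies outside the range of [denominator_upto]; its coefficient is written over [d]
   directly. *)
- exists ((coef_n iota (a (Ordinal lr)))%:P%:P * d).
  by rewrite tofracM mulfK // tofrac_eq0.
have [|p ->] := dP l.+1; first by rewrite -ltnS.
exists ((coef_n iota (a (Ordinal lr)))%:P%:P * p).
by rewrite scalerA tofracM mulrA.
Qed.

End Telescoping.

(** The identity is solved for the one term not visibly divisible. The last two products are ordered
    as the first two with i and j exchanged, so that the same lemmas apply to them. *)
Lemma telescoping_divides (R : idomainType)
    (P d di dj f1 f1i f2 f2j g1' g2' v g1i g2j r1 r2 s s1' s2' : R) :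
    P * di * dj * g1i * g2j * g1' * g2' * v * s * s1' * s2' =
      d * dj * f1i * g2j * g1' * g2' * v * (r1 * s2')
      - di * dj * f1 * g2' * g1i * g2j * (s1' * s * s2')
      + d * di * f2j * g1i * g1' * g2' * v * (r2 * s1')
      - di * dj * f2 * g1' * g1i * g2j * (s2' * s * s1') ->
  [/\ dvdr g1' (di * dj * f1 * g2' * g1i * g2j * (s1' * s * s2')),
      dvdr g1i (d * dj * f1i * g2j * g1' * g2' * v * (r1 * s2')),
      dvdr g2' (dj * di * f2 * g1' * g2j * g1i * (s2' * s * s1'))
    & dvdr g2j (d * di * f2j * g1i * g2' * g1' * v * (r2 * s1'))].
Proof.
move=> /eqP; rewrite -subr_eq0 => /eqP E0; split.
- exists (d * dj * f1i * g2j * g2' * v * (r1 * s2')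
    + d * di * f2j * g1i * g2' * v * (r2 * s1')
    - di * dj * f2 * g1i * g2j * (s2' * s * s1')
    - P * di * dj * g1i * g2j * g2' * v * s * s1' * s2').
  by rewrite -[LHS]subr0 -E0; ring.
- exists (P * di * dj * g2j * g1' * g2' * v * s * s1' * s2'
    + di * dj * f1 * g2' * g2j * (s1' * s * s2')
    - d * di * f2j * g1' * g2' * v * (r2 * s1')
    + di * dj * f2 * g1' * g2j * (s2' * s * s1')).
  by rewrite -[LHS]addr0 -E0; ring.
- exists (d * dj * f1i * g2j * g1' * v * (r1 * s2')
    + d * di * f2j * g1i * g1' * v * (r2 * s1')
    - di * dj * f1 * g1i * g2j * (s1' * s * s2')
    - P * di * dj * g1i * g2j * g1' * v * s * s1' * s2').
  by rewrite -[LHS]subr0 -E0; ring.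
exists (P * di * dj * g1i * g1' * g2' * v * s * s1' * s2'
  + di * dj * f1 * g2' * g1i * (s1' * s * s2')
  - d * dj * f1i * g1' * g2' * v * (r1 * s2')
  + di * dj * f2 * g1' * g1i * (s2' * s * s1')).
by rewrite -[LHS]addr0 -E0; ring.
Qed.

(** * Sorting primes into K[i], K[j] and polynomials in i + j *)

Section PrimeClasses.
Variable K : fieldType.
Implicit Types (l : seq (bipoly K)) (p g : bipoly K).

Definition in_i p := `[< exists q : {poly K}, p = q^:P >].
Definition in_j p := `[< exists q : {poly K}, p = q%:P >].
Definition in_iDj p := `[< exists q : {poly K}, p = poly_XaY q >].

Lemma prod_in_i l : exists q : {poly K}, \prod_(p <- filter in_i l) p = q^:P.
Proof.
apply: (prod_image (phi := map_poly polyC)) => p.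
by rewrite mem_filter => /andP[/asboolP].
Qed.

Lemma prod_in_j l : exists q : {poly K}, \prod_(p <- filter in_j l) p = q%:P.
Proof.
apply: (prod_image (phi := polyC)) => p.
by rewrite mem_filter => /andP[/asboolP].
Qed.

Lemma prod_in_iDj l :
  exists q : {poly K}, \prod_(p <- filter in_iDj l) p = poly_XaY q.
Proof.
rewrite big_seq; elim/big_ind: _ => [|_ _ [q ->] [r ->]|p].
- by exists 1; rewrite /poly_XaY rmorph1 comp_polyC.
- by exists (q * r); rewrite /poly_XaY rmorphM comp_polyM.
by rewrite mem_filter => /andP[/asboolP].
Qed.

End PrimeClasses.

Lemma unit_stepN h : unit_step h -> unit_step (- h).
Proof. by rewrite /unit_step !inE => /or3P[]/eqP->. Qed.

Theorem theorem2
  (k K : fieldType) (K_char0 : [pchar K] =i pred0)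
  (iota : {rmorphism {fraction {poly k}} -> K})
  (M : lmodType (birat K)) (N Si Sj : {additive M -> M})
  (shiftsM : shift_operators iota N Si Sj)
  (F : M) (F_hyp : hypergeometric iota N Si Sj F)
  (r1 s1 r2 s2 : bipoly K) (s1_neq0 : s1 != 0) (s2_neq0 : s2 != 0)
  (SiF : Si F = (tofrac r1 / tofrac s1) *: F)
  (SjF : Sj F = (tofrac r2 / tofrac s2) *: F)
  (r1s1 : rel_prime r1 s1) (r2s2 : rel_prime r2 s2)
  (s s1' s2' : bipoly K) (s_gcd : is_gcd s s1 s2)
  (s1E : s1 = s1' * s) (s2E : s2 = s2' * s)
  (r : nat) (d : bipoly K) (d_den : common_denominator N F r d)
  (a : 'I_r.+1 -> {poly k})
  (f1 g1 f2 g2 : bipoly K) (g1_neq0 : g1 != 0) (g2_neq0 : g2 != 0)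
  (f1g1 : rel_prime f1 g1) (f2g2 : rel_prime f2 g2)
  (R1 R2 : birat K)
  (R1E : R1 = 1 / tofrac d * (tofrac f1 / tofrac g1))
  (R2E : R2 = 1 / tofrac d * (tofrac f2 / tofrac g2))
  (telescoping :
     apply_op iota N a F = fdiff Si (R1 *: F) + fdiff Sj (R2 *: F))
  (v g1' g2' : bipoly K) (v_gcd : is_gcd v g1 g2)
  (g1E : g1 = g1' * v) (g2E : g2 = g2' * v)
  (H1 : isolated_factors g1 /\ isolated_factors g2)
  (H2 : rel_prime g1' v /\ rel_prime g2' v)
  (H3 : forall h1 h2 : int, unit_step h1 -> unit_step h2 ->
     rel_prime (shift_ij h1 h2 g1') g2')
  (Hd : forall h1 h2 : int, unit_step h1 -> unit_step h2 ->
     rel_prime g1 (shift_ij h1 h2 d) /\ rel_prime g2 (shift_ij h1 h2 d)) :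
  exists (v1 w1 v2 u1 v3 : {poly K}) (v4 u2 w2 : bipoly K),
    [/\ g1 = v1^:P * v2%:P * poly_XaY v3 * v4 * u1%:P * u2
          /\ g2 = v1^:P * v2%:P * poly_XaY v3 * v4 * w1^:P * w2,
        divides v1^:P (shift_ij (-1) 0 r1 * shift_ij (-1) 0 s2')
          /\ divides v2%:P (shift_ij 0 (-1) r2 * shift_ij 0 (-1) s1'),
        divides_gcd v4 (shift_ij (-1) 0 r1 * shift_ij (-1) 0 s2')
                       (shift_ij 0 (-1) r2 * shift_ij 0 (-1) s1'),
        divides_gcd u2 (s1 * s2')
                       (shift_ij (-1) 0 r1 * shift_ij (-1) 0 s2')
      & divides_gcd w2 (s2 * s1')
                       (shift_ij 0 (-1) r2 * shift_ij 0 (-1) s1')].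
Proof.
have [[_ Si_inj Sj_inj] _ [_ SiZ SjZ]] := shiftsM.
have [F0 _] := F_hyp.
have [d_upto _ _] := d_den; have [d0 _] := d_upto.
(* This makes the first argument of the gcd for [v4] nonzero, as [divides_gcdI] requires. *)
have r10 : r1 != 0.
  apply: contraNneq F0 => r10; apply/eqP/Si_inj.
  by rewrite SiF r10 tofrac0 mul0r scale0r raddf0.
have K0 : char0 K by move/pcharf0P: K_char0 => K0 n; rewrite K0.
have [P PE] := apply_op_quotient iota a d_upto.
rewrite {}PE in telescoping.
subst g1 g2 s1 s2 R1 R2.
have [s1'0 s2'0] : s1' != 0 /\ s2' != 0.
  by split; [move: s1_neq0|move: s2_neq0]; apply: contraNneq => ->; rewrite mul0r.
have [g1'0 v0] : g1' != 0 /\ v != 0 by apply/andP; rewrite -negb_or -mulf_eq0.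
have g2'0 : g2' != 0 by apply: contraNneq g2_neq0 => ->; rewrite mul0r.
pose sh := @shift_ij_rmorphism K.
(* With [sh'] the roles of i and j are exchanged, so each lemma on g1 also yields its counterpart
   for g2. *)
pose sh' (h1 h2 : int) := sh h2 h1.
have sh00 x : sh 0 0 x = x by apply: shift_ij00.
have sh00' x : sh' 0 0 x = x by apply: shift_ij00.
have shD h1 h2 h1' h2' x : sh h1 h2 (sh h1' h2' x) = sh (h1 + h1') (h2 + h2') x.
  exact: shift_ijD.
have shD' h1 h2 h1' h2' x :
    sh' h1 h2 (sh' h1' h2' x) = sh' (h1 + h1') (h2 + h2') x.
  exact: shift_ijD.
have sh_neq0 h1 h2 p : p != 0 -> sh h1 h2 p != 0 by apply: shift_ij_neq0.
have := @telescoping_identity K M Si Sj (sh 1 0) (sh 0 1) F P d f1 f2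
  g1' g2' v r1 r2 s s1' s2' SiZ SjZ (sh_neq0 1 0) (sh_neq0 0 1) F0 d0
  g1_neq0 g2_neq0 s1_neq0 s2_neq0 SiF SjF telescoping.
move=> /telescoping_divides[g1'_dvd g1_dvd g2'_dvd g2_dvd].
have [g1_isol g2_isol] : isolated sh (g1' * v) /\ isolated sh (g2' * v).
  by have [] := H1; split; apply: isolated_factors_isolated.
have [g1_isol' g2_isol'] : isolated sh' (g1' * v) /\ isolated sh' (g2' * v).
  by split=> p h1 h2 h1S h2S; [apply: g1_isol|apply: g2_isol].
have g1d h1 h2 : unit_step h1 -> unit_step h2 -> coprimer (g1' * v) (sh h1 h2 d).
  by move=> h1S h2S; have [] := Hd _ _ h1S h2S => + _; apply: rel_prime_coprimer.
have g2d h1 h2 : unit_step h1 -> unit_step h2 -> coprimer (g2' * v) (sh' h1 h2 d).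
  by move=> h1S h2S; have [_] := Hd _ _ h2S h1S; apply: rel_prime_coprimer.
have [g1v g2v] : coprimer g1' v /\ coprimer g2' v.
  by have [] := H2; split; apply: rel_prime_coprimer.
have g12 h1 h2 : unit_step h1 -> unit_step h2 -> coprimer (sh h1 h2 g1') g2'.
  by move=> h1S h2S; apply/rel_prime_coprimer/H3.
have g21 h1 h2 : unit_step h1 -> unit_step h2 -> coprimer (sh' h1 h2 g2') g1'.
  move=> h1S h2S; apply: coprimer_sym; apply: (coprimer_shV sh00 shD).
  by apply: g12; apply: unit_stepN.
have fg1 := rel_prime_coprimer f1g1; have fg2 := rel_prime_coprimer f2g2.
have stable_i h p : h != 0 -> stable sh h 0 p -> in_j p.
  by move=> h0 [u uU pE]; apply/asboolP; apply: (shift_i_stable K0 h0 uU pE).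
have stable_j h p : h != 0 -> stable sh' h 0 p -> in_i p.
  by move=> h0 [u uU pE]; apply/asboolP; apply: (shift_j_stable K0 h0 uU pE).
have stable_iDj h p : h != 0 -> stable sh (- h) h p -> in_iDj p.
  by move=> h0 [u uU pE]; apply/asboolP; apply: (shift_antidiag_stable K0 h0 uU pE).
have [c1 [l1 [c1U l1P g1'E]]] := @factorial_bipoly K g1' g1'0.
have [c2 [l2 [c2U l2P g2'E]]] := @factorial_bipoly K g2' g2'0.
have [cv [l [cvU lP vE]]] := @factorial_bipoly K v v0.
set A1 := shift_ij (-1) 0 r1 * _; set A2 := shift_ij 0 (-1) r2 * _.
have A10 : A1 != 0 by rewrite mulf_neq0 ?sh_neq0.
have A1E : A1 = sh (-1) 0 (r1 * s2') by rewrite rmorphM.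
have A2E : A2 = sh' (-1) 0 (r2 * s1') by rewrite rmorphM.
pose l1' := [seq p <- l1 | predC (@in_j K) p].
pose l2' := [seq p <- l2 | predC (@in_i K) p].
pose lA := [seq p <- l | predC (@in_iDj K) p].
pose lB := [seq p <- lA | predC (@in_i K) p].
pose lC := [seq p <- lB | predC (@in_j K) p].
have [u1 u1E] := prod_in_j l1; have [w1 w1E] := prod_in_i l2.
have [v3 v3E] := prod_in_iDj l; have [v1 v1E] := prod_in_i lA.
have [v2 v2E] := prod_in_j lB.
(* The unit of the factorization of v is absorbed here, where divisibility is insensitive to it. *)
pose v4 := cv * \prod_(p <- lC) p.
have l1'P : all_prime l1' by apply: all_prime_filter.
have l2'P : all_prime l2' by apply: all_prime_filter.
have lAP : all_prime lA by apply: all_prime_filter.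
have lBP : all_prime lB by apply: all_prime_filter.
have l1'_dvd : dvdr (\prod_(p <- l1') p) g1'.
  by rewrite g1'E; apply/dvdr_mull/dvdr_prod_filter.
have l2'_dvd : dvdr (\prod_(p <- l2') p) g2'.
  by rewrite g2'E; apply/dvdr_mull/dvdr_prod_filter.
have lA_dvd : dvdr (\prod_(p <- lA) p) v.
  by rewrite vE; apply/dvdr_mull/dvdr_prod_filter.
have lB_dvd : dvdr (\prod_(p <- lB) p) v.
  exact: dvdr_trans (dvdr_prod_filter _ _) lA_dvd.
have l1'_stable h p : h != 0 -> p \in l1' -> ~ stable sh h 0 p.
  by move=> h0; rewrite mem_filter => /andP[/negP pNj _] /(stable_i _ _ h0).
have l2'_stable h p : h != 0 -> p \in l2' -> ~ stable sh' h 0 p.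
  by move=> h0; rewrite mem_filter => /andP[/negP pNi _] /(stable_j _ _ h0).
have lA_stable h p : h != 0 -> p \in lA -> ~ stable sh (- h) h p.
  by move=> h0; rewrite mem_filter => /andP[/negP pNd _] /(stable_iDj _ _ h0).
have num1 := common_dvd_numerators sh00 shD g1_isol g2_isol g1d fg1 g1_dvd.
have num2 := common_dvd_numerators sh00' shD' g2_isol' g1_isol' g2d fg2 g2_dvd.
exists v1, w1, v2, u1, v3, v4, (c1 * \prod_(p <- l1') p), (c2 * \prod_(p <- l2') p).
split.
- have vE' : v = v1^:P * v2%:P * poly_XaY v3 * v4.
    rewrite vE (prod_filterC (@in_iDj K)) v3E (prod_filterC (@in_i K)) v1E.
    by rewrite (prod_filterC (@in_j K)) v2E /v4; ring.
  rewrite -vE' {1}g1'E {1}g2'E (prod_filterC (@in_j K) l1) u1E.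
  by rewrite (prod_filterC (@in_i K) l2) w1E; split; ring.
- split.
    rewrite -v1E A1E; apply: num1.
    + exact: all_prime_filter.
    + exact: dvdr_trans (dvdr_prod_filter _ _) lA_dvd.
    + move=> p; rewrite mem_filter => /andP[/asboolP[q qE] /lAP pP].
      (* A prime in K[i] stable under a shift in i would also lie in K[j], hence be a unit. *)
      move=> /(stable_i _ _ (oner_neq0 _))/asboolP[q'].
      exact: prime_neq_univariate pP qE.
    (* [lA_stable] concerns the shift (-h, h): h = -1 gives the (1, -1) of [num1], and h = 1 the
       exchanged shift of [num2]. *)
    + by move=> p; rewrite mem_filter => /andP[_]; apply: (lA_stable (-1)).
  rewrite -v2E A2E; apply: num2.
  + exact: all_prime_filter.
  + exact: dvdr_trans (dvdr_prod_filter _ _) lB_dvd.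
  + move=> p; rewrite mem_filter => /andP[_]; rewrite mem_filter.
    by move=> /andP[/negP pNi _] /(stable_j _ _ (oner_neq0 _)).
  + move=> p; rewrite !mem_filter => /andP[_ /andP[_ pA]].
    by apply: (lA_stable 1); rewrite // mem_filter.
- apply: divides_gcdI => //; apply: (dvdr_mul_unit cvU); rewrite ?A1E ?A2E.
    apply: num1.
    + exact: all_prime_filter.
    + exact: dvdr_trans (dvdr_prod_filter _ _) lB_dvd.
    + move=> p; rewrite mem_filter => /andP[/negP pNj _].
      by move=> /(stable_i _ _ (oner_neq0 _)).
    + move=> p; rewrite !mem_filter => /andP[_ /andP[_ pA]].
      by apply: (lA_stable (-1)); rewrite // mem_filter.
  apply: num2.
  + exact: all_prime_filter.
  + exact: dvdr_trans (dvdr_prod_filter _ _) lB_dvd.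
  + move=> p; rewrite mem_filter => /andP[_]; rewrite mem_filter.
    by move=> /andP[/negP pNi _] /(stable_j _ _ (oner_neq0 _)).
  + move=> p; rewrite !mem_filter => /andP[_ /andP[_ pA]].
    by apply: (lA_stable 1); rewrite // mem_filter.
- apply: divides_gcdI; [exact: mulf_neq0| |]; apply: (dvdr_mul_unit c1U).
    apply: (cofactor_dvd_denominators sh00 shD g1_isol g1d fg1 g1v g12 g1'_dvd)
      => //.
    by move=> p; apply: l1'_stable.
  rewrite A1E.
  apply: (cofactor_dvd_numerators sh00 shD g1_isol g1d fg1 g1v g12 g1_dvd) => //.
  by move=> p; apply: l1'_stable.
apply: divides_gcdI; [exact: mulf_neq0| |]; apply: (dvdr_mul_unit c2U).
  apply: (cofactor_dvd_denominators sh00' shD' g2_isol' g2d fg2 g2v g21 g2'_dvd)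
    => //.
  by move=> p; apply: l2'_stable.
rewrite A2E.
apply: (cofactor_dvd_numerators sh00' shD' g2_isol' g2d fg2 g2v g21 g2_dvd) => //.
by move=> p; apply: l2'_stable.
Qed.
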